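(* The topological closure $\overline{\mathrm{TS}}$ of $\mathrm{TS}$ in $\beta\mathbb N^2$ coincides with $\mathrm{RW}$.
   Context: $\mathbb N$ is the set of positive integers. $\beta\mathbb N^k$ denotes the space of ultrafilters on $\mathbb N^k$, with basic clopen sets $\{u\in\beta\mathbb N^k\mid A\in u\}$ for $A\subseteq\mathbb N^k$; elements of $\mathbb N$ are identified with principal ultrafilters in $\beta\mathbb N$. For $u,v\in\beta\mathbb N$, the tensor product $u\otimes v\in\beta\mathbb N^2$ is defined by: $A\in u\otimes v$ iff $\{n\in\mathbb N\mid\{m\in\mathbb N\mid(n,m)\in A\}\in v\}\in u$. The set of tensor squares is $\mathrm{TS}=\{u\otimes u\mid u\in\beta\mathbb N\setminus\mathbb N\}$. For $H\subseteq\mathbb N$, $[H]^2=\{(h_1,h_2)\in H^2\mid h_1<h_2\}$. $\mathrm{RW}$ is the set of Ramsey's witnesses, that is, of those $u\in\beta\mathbb N^2$ such that for every $A\in u$ there is an infinite $H\subseteq\mathbb N$ with $[H]^2\subseteq A$. *)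

(* Defs.v *)
From HB Require Import structures.
From mathcomp Require Import all_boot.
From mathcomp Require Import boolp classical_sets functions cardinality filter.
From mathcomp Require Import topology_structure.

Set Implicit Arguments.
Unset Strict Implicit.
Unset Printing Implicit Defensive.

Local Open Scope classical_set_scope.

(* The Stone-Cech space beta T of the discrete type T, as ultrafilters on T. *)
Record ultrafilters (T : Type) := Ultrafilter {
  ultra_sets :> set T -> Prop;
  ultra_setsP : UltraFilter ultra_sets
}.
#[global] Existing Instance ultra_setsP.

HB.instance Definition _ (T : Type) := gen_eqMixin (ultrafilters T).
HB.instance Definition _ (T : Type) := gen_choiceMixin (ultrafilters T).

Definition stone_basic (T : Type) (A : set T) : set (ultrafilters T) :=
  [set u : ultrafilters T | u A].

Lemma stone_basic_cover (T : Type) :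
  \bigcup_(A in [set: set T]) stone_basic A = setT.
Proof. by apply/seteqP; split=> // u _; exists setT => //; exact: filterT. Qed.

Lemma stone_basic_join (T : Type) (A B : set T) (u : ultrafilters T) :
  [set: set T] A -> [set: set T] B -> stone_basic A u -> stone_basic B u ->
  exists C : set T, [/\ [set: set T] C, stone_basic C u &
    stone_basic C `<=` stone_basic A `&` stone_basic B].
Proof.
move=> _ _ uA uB; exists (A `&` B); split=> //; first exact: filterI.
by move=> v vAB; split; apply: filterS vAB => x [].
Qed.

HB.instance Definition _ (T : Type) :=
  isBaseTopological.Build (ultrafilters T)
    (@stone_basic_cover T) (@stone_basic_join T).

Definition principal (T : Type) (x : T) : ultrafilters T :=
  Ultrafilter (principal_filter_ultra x).

Definition tensor_sets (S T : Type) (u : set_system S) (v : set_system T) :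
    set_system (S * T) :=
  [set A | u [set n | v [set m | A (n, m)]]].

Lemma tensor_sets_ultra (S T : Type) (u : ultrafilters S) (v : ultrafilters T) :
  UltraFilter (tensor_sets u v).
Proof.
split.
  split.
    move=> u0; apply: (@filter_not_empty _ u _).
    by apply: (@filterS _ u _ _ _ _ u0) => n /(@filter_not_empty _ v _).
  split.
  - by apply: (@filterS _ u _ _ _ _ filterT) => n _; exact: (@filterT _ v).
  - move=> A B uA uB.
    apply: (@filterS _ u _ _ _ _ (@filterI _ u _ _ _ uA uB)) => n [vA vB].
    exact: (@filterI _ v _ _ _ vA vB).
  - move=> A B AB; apply: (@filterS _ u) => n.
    by apply: (@filterS _ v) => m; exact: AB.
move=> G GF uvG; apply/seteqP; split=> // A GA.
have [//|uNA] := in_ultra_setVsetC [set n | v [set m | A (n, m)]] (ultra_setsP u).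
have : G (~` A).
  apply: uvG; apply: (@filterS _ u _ _ _ _ uNA) => n nvA.
  by have [] := in_ultra_setVsetC [set m | A (n, m)] (ultra_setsP v).
by move=> /(filterI GA); rewrite setICr => /(@filter_not_empty _ G _).
Qed.

Definition tensor (S T : Type) (u : ultrafilters S) (v : ultrafilters T) :
    ultrafilters (S * T) :=
  Ultrafilter (tensor_sets_ultra u v).

(* Here 0 is not a natural number. *)
Definition posn : Type := {n : nat | (0 < n)%N}.

Definition tensor_squares : set (ultrafilters (posn * posn)) :=
  [set tensor u u | u in ~` range (@principal posn)].

Definition increasing_pairs (H : set posn) : set (posn * posn) :=
  [set h | [/\ H h.1, H h.2 & (val h.1 < val h.2)%N]].

Definition ramsey_witnesses : set (ultrafilters (posn * posn)) :=
  [set u : ultrafilters (posn * posn) | forall A, u A ->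
    exists H : set posn, infinite_set H /\ increasing_pairs H `<=` A].

(* Main.v *)
(* Basic neighbourhoods of an ultrafilter are indexed by its members, so it is
   enough to compare, for a single set A, the existence of a nonprincipal u with A in
   u (x) u and of an infinite H with [H]^2 included in A. Given u, pick the elements of H one by one inside a decreasing sequence
   of members of u, each time intersecting with the fibre
   {m | (n, m) in A, n < m} of the element n just picked. Conversely, any
   nonprincipal u containing H has [H]^2 in u (x) u. *)
Require Import Defs.
From mathcomp Require Import all_boot.
From mathcomp Require Import finmap.
From mathcomp Require Import boolp classical_sets functions cardinality filter.
From mathcomp Require Import topology_structure.

Local Open Scope classical_set_scope.

(** Ultrafilters are maximal among proper filters; the proof fields agree by proof irrelevance. *)
Lemma ultrafilters_subset_eq (T : Type) (u v : ultrafilters T) :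
  (forall A, u A -> v A) -> v = u.
Proof.
case: u v => [u uP] [v vP] /= uv.
have E : v = u by exact: max_filter.
by case: _ / E uP uv => uP _; congr Ultrafilter; exact: Prop_irrelevance.
Qed.

Lemma nonprincipal_cosingleton (T : Type) (u : ultrafilters T) (x : T) :
  ~ range (@principal T) u -> u (~` [set x]).
Proof.
move=> up; have [ux|//] := in_ultra_setVsetC [set x] (ultra_setsP u).
exfalso; apply: up; exists x => //; apply: ultrafilters_subset_eq => A uA.
have [y [Ay yx]] := @filter_ex _ u _ _ (@filterI _ u _ _ _ uA ux).
by move: Ay; rewrite yx => Ax; apply/principal_filterP.
Qed.

Lemma nonprincipal_cofinite (T : choiceType) (u : ultrafilters T) (F : set T) :
  ~ range (@principal T) u -> finite_set F -> u (~` F).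
Proof.
move=> up /finite_fsetP[X ->].
have : u (\bigcap_(x in [set` X]) ~` [set x]).
  by apply: filter_bigI => x _; exact: nonprincipal_cosingleton.
by apply: (@filterS _ u _) => y Xy /= yX; exact: (Xy y).
Qed.

(** The sets containing all but finitely many points of [H] form a filter, proper because [H] is
    infinite. Any ultrafilter extending it contains the complement of every singleton. *)
Lemma infinite_set_nonprincipal (T : Type) (H : set T) :
  infinite_set H -> exists2 u : ultrafilters T, ~ range (@principal T) u & u H.
Proof.
move=> Hinf; pose F : set_system T := [set A | finite_set (H `\` A)].
have FP : ProperFilter F.
  split; first by rewrite /F /= setD0.
  split.
  - by rewrite /F /= setDT.
  - by move=> A B FA FB; rewrite /F /= setDIr finite_setU.
  - by move=> A B AB; apply: sub_finite_set; exact: setDS.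
have [G [GU FG]] := @ultraFilterLemma T F FP.
exists (Ultrafilter GU) => /=; last by apply: FG; rewrite /F /= setDv.
move=> [x _ /(congr1 (fun v : ultrafilters T => v (~` [set x])))] /= E.
suff : G (~` [set x]) by rewrite -E => /principal_filterP/(_ erefl).
by apply: FG; apply: (sub_finite_set _ (finite_set1 x)) => y [_ /contrapT].
Qed.

Lemma finite_posn_le (n : posn) : finite_set [set m : posn | (val m <= val n)%N].
Proof.
apply: (@finite_preimage _ _ [set k | (k <= val n)%N] val).
  by move=> ? ? _ _; exact: val_inj.
by apply: (sub_finite_set _ (finite_II (val n).+1)) => k /=; rewrite ltnS.
Qed.

Lemma nonprincipal_gt (u : ultrafilters posn) (n : posn) :
  ~ range (@principal posn) u -> u [set m | (val n < val m)%N].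
Proof.
move=> up; have := nonprincipal_cofinite _ _ _ up (finite_posn_le n).
by apply: (@filterS _ u _) => m /= /negP; rewrite -ltnNge.
Qed.

Lemma infinite_range_injective (T : Type) (h : nat -> T) :
  injective h -> infinite_set (range h).
Proof.
move=> hinj /(@finite_preimage _ _ _ h (fun i j _ _ => hinj i j)).
by rewrite preimage_range; exact: infinite_nat.
Qed.

Lemma tensor_square_increasing_pairs (u : ultrafilters posn)
    (A : set (posn * posn)) :
  ~ range (@principal posn) u -> tensor u u A ->
  exists H : set posn, infinite_set H /\ increasing_pairs H `<=` A.
Proof.
(* [uA] says exactly that [D] is in [u]. Picking only from subsets of [D] keeps the fibre of every
   chosen point in [u]. *)
move=> up uA; pose D : set posn := [set n | u [set m | A (n, m)]].
(* A mere default for [xget]: each [C k] is in [u], hence nonempty. *)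
pose x0 : posn := exist _ 1%N isT.
pose next (C : set posn) :=
  C `&` [set m | A (xget x0 C, m) /\ (val (xget x0 C) < val m)%N].
pose C k := iter k next D; pose h k := xget x0 (C k).
have CS i j : (i <= j)%N -> C j `<=` C i.
  move/subnK <-; elim: (j - i)%N => [|k IH] // m; rewrite addSn => -[Cm _].
  exact: IH.
have hC k : u (C k) -> C k (h k).
  by move=> /(@filter_ex _ u _); exact: xgetPex.
have uC k : u (C k).
  elim: k => [//|k uCk]; apply: (@filterI _ u _ _ _ uCk).
  apply: (@filterI _ u _); last exact: nonprincipal_gt.
  (* [C 0] is [D], so the fibre of [h k] is in [u]. *)
  exact: (CS 0 k _ _ (hC k uCk)).
have hP i j : (i < j)%N -> A (h i, h j) /\ (val (h i) < val (h j))%N.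
  (* [i < j] unfolds to [i.+1 <= j], so [h j] lies in [C i.+1], which was cut down by the
     constraints from [h i]. *)
  by move=> ij; have [] := CS _ _ ij _ (hC j (uC j)).
have hinj : injective h.
  by move=> i j hij; have [/hP[_]|/hP[_]|//] := ltngtP i j; rewrite hij ltnn.
exists (range h); split.
  exact: infinite_range_injective.
move=> [_ _] [/= [i _ <-] [j _ <-] hij].
(* As [h] is strictly increasing, only [i < j] is compatible with [hij]. *)
have [/hP[]//|/hP[_ hji]|ij] := ltngtP i j.
  by move: (ltn_trans hij hji); rewrite ltnn.
by move: hij; rewrite ij ltnn.
Qed.

Lemma infinite_increasing_pairs_tensor_square (H : set posn) :
  infinite_set H ->
  exists2 u : ultrafilters posn,
    ~ range (@principal posn) u & tensor u u (increasing_pairs H).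
Proof.
move=> /infinite_set_nonprincipal[u up uH]; exists u => //.
apply: (@filterS _ u _ _ _ _ uH) => n Hn.
have uHn : u (H `&` [set m | (val n < val m)%N]).
  by apply: (@filterI _ u _ _ _ uH); exact: nonprincipal_gt.
by apply: (@filterS _ u _ _ _ _ uHn) => m [].
Qed.

Lemma open_stone_basic (T : Type) (A : set T) : open (stone_basic A).
Proof. by exists [set A] => //; rewrite bigcup_set1. Qed.

(** The sets [stone_basic A] with [w A] form a neighbourhood base at [w]. *)
Lemma closure_stone_basic (T : Type) (S : set (ultrafilters T))
    (w : ultrafilters T) :
  closure S w <-> forall A, w A -> exists2 u : ultrafilters T, S u & u A.
Proof.
split=> [Sw A wA|Sw B].
  have [|u [Su uA]] := Sw (stone_basic A); last by exists u.
  by apply: open_nbhs_nbhs; split=> //; exact: open_stone_basic.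
rewrite nbhsE => -[_ [[D _ <-] [A DA wA]] DB].
have [u Su uA] := Sw A wA.
by exists u; split=> //; apply: DB; exists A.
Qed.

Theorem theorem2p10 : closure tensor_squares = ramsey_witnesses.
Proof.
apply/seteqP; split=> w.
- move=> /closure_stone_basic wTS A /wTS[_ [u up <-]].
  exact: tensor_square_increasing_pairs.
- move=> wR; apply/closure_stone_basic => A /wR[H [Hinf HA]].
  have [u up uH] := infinite_increasing_pairs_tensor_square H Hinf.
  by exists (tensor u u); [exists u|exact: filterS uH].
Qed.
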